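(* Let $\Omega$ be a topological signature, let $A$ be a profinite $\Omega$-algebra and let $\theta$ be a closed congruence on $A$ (i.e. a congruence that is a closed subset of $A\times A$) such that the quotient space $A/\theta$ is 0-dimensional. Then the quotient algebra $A/\theta$ is profinite.
   Context: A topological signature is a sequence $\Omega=(\Omega_n)_{n\in\mathbb{N}}$ (with $0\in\mathbb{N}$) of topological spaces. An $\Omega$-algebra is a set $A$ with evaluation maps $E_n^A:\Omega_n\times A^n\to A$ ($n\in\mathbb{N}$); for $w\in\Omega_n$ write $w_A(a_1,\ldots,a_n)=E_n^A(w,a_1,\ldots,a_n)$. It is a topological $\Omega$-algebra if $A$ is a topological space and every $E_n^A$ is continuous. Compact spaces are required to be Hausdorff. Finite algebras are viewed as discrete topological algebras (the evaluation maps being required to be continuous). A topological algebra $A$ is residually finite if for all distinct $a,a'\in A$ there is a continuous homomorphism $\varphi:A\to B$ into a finite (discrete) topological algebra with $\varphi(a)\neq\varphi(a')$; $A$ is profinite if it is compact and residually finite. A congruence on $A$ is an equivalence relation compatible with all operations $w_A$. The quotient $A/\theta$ carries the quotient topology and the operations $w_{A/\theta}(a_1/\theta,\ldots,a_n/\theta)=w_A(a_1,\ldots,a_n)/\theta$. *)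

(* Defs.v *)
From HB Require Import structures.
From mathcomp Require Import all_boot.
From mathcomp Require Import all_classical.
From mathcomp Require Import topology.

Set Implicit Arguments.
Unset Strict Implicit.
Unset Printing Implicit Defensive.

Local Open Scope classical_set_scope.
Local Open Scope quotient_scope.

Definition signature : Type := nat -> topologicalType.

(* [{ptws 'I_n -> A}] is the function type ['I_n -> A] with the product
   topology; no nonemptiness of A or of the Omega n is assumed. *)
Definition operations (Omega : signature) (A : topologicalType) : Type :=
  forall n : nat, Omega n * {ptws 'I_n -> A} -> A.

Definition topological_algebra (Omega : signature) (A : topologicalType)
    (E : operations Omega A) : Prop :=
  forall n : nat, continuous (E n).

Definition homomorphism (Omega : signature) (A B : topologicalType)
    (E : operations Omega A) (F : operations Omega B) (phi : A -> B) : Prop :=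
  forall (n : nat) (w : Omega n) (a : 'I_n -> A),
    phi (E n (w, a)) = F n (w, phi \o a).

Definition residually_finite (Omega : signature) (A : topologicalType)
    (E : operations Omega A) : Prop :=
  forall a a' : A, a <> a' ->
    exists (B : discreteTopologicalType) (F : operations Omega B)
           (phi : A -> B),
      [/\ finite_set [set: B], topological_algebra F, continuous phi,
          homomorphism E F phi & phi a <> phi a'].

Definition profinite (Omega : signature) (A : topologicalType)
    (E : operations Omega A) : Prop :=
  [/\ topological_algebra E, hausdorff_space A, compact [set: A]
    & residually_finite E].

Definition compatible (Omega : signature) (A : topologicalType)
    (E : operations Omega A) (theta : equiv_rel A) : Prop :=
  forall (n : nat) (w : Omega n) (a b : 'I_n -> A),
    (forall i, theta (a i) (b i)) -> theta (E n (w, a)) (E n (w, b)).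

Definition quotient_space (A : topologicalType) (theta : equiv_rel A)
    : topologicalType :=
  quotient_topology {eq_quot theta}.

(* Computed on chosen representatives; [quotient_operationsE] is the usual
   characterization for a compatible theta. *)
Definition quotient_operations (Omega : signature) (A : topologicalType)
    (E : operations Omega A) (theta : equiv_rel A)
    : operations Omega (quotient_space theta) :=
  fun n p => \pi_(quotient_topology {eq_quot theta})
               (E n (p.1, fun i => repr (p.2 i : {eq_quot theta}))).
Arguments quotient_operations {Omega A} E theta n p .

Lemma quotient_operationsE (Omega : signature) (A : topologicalType)
    (E : operations Omega A) (theta : equiv_rel A) :
  compatible E theta ->
  forall (n : nat) (w : Omega n) (a : 'I_n -> A),
    quotient_operations E theta n
      (w, fun i => \pi_(quotient_topology {eq_quot theta}) (a i))
    = \pi_(quotient_topology {eq_quot theta}) (E n (w, a)).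
Proof.
move=> cE n w a; apply/eqmodP; apply: cE => i; apply/eqmodP.
exact: reprK.
Qed.

(* The library's [zero_dimensional] only asks clopen sets to separate points,
   which is weaker than having a base of clopen sets outside compact spaces. *)
Definition has_clopen_base (T : topologicalType) : Prop := basis (@clopen T).

(* Main.v *)
Require Import Defs.
From mathcomp Require Import all_boot.
From mathcomp Require Import all_classical.
From mathcomp Require Import topology.
From Stdlib Require Import Relation_Operators.

(** The theorem follows from one fact: for every clopen subset [U] of
    [A/theta] there is a continuous homomorphism from [A/theta] to a finite
    discrete algebra that has [U] as a union of fibres
    ([clopen_finite_quotient]).

    To see this, let [V] be the preimage of [U] in [A]. The clopen set [V] is
    a union of classes of some open congruence [R]: every pair in the compact
    set [V * (A \ V)] is separated by the kernel of a homomorphism to a finite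
    algebra, such kernels are open congruences, and by compactness one finite
    intersection of them separates all these pairs at once
    ([clopen_saturated_open_congruence]). Both [theta] and [R] saturate [V],
    hence so does their join [J] in the lattice of congruences. As [J] contains
    [R], its classes are open ([open_congruence_join]), so compactness of [A]
    makes [A/J] a finite discrete topological algebra
    ([open_congruence_quotient]); as [J] contains [theta], the projection
    [A -> A/J] factors through [A/theta].

    Points of [A/theta] are closed because [theta] is, so the clopen base
    separates them by clopen sets ([quotient_clopen_separation]). This gives
    the Hausdorff property and, with the homomorphisms above, residual
    finiteness. The same homomorphisms give the continuity of the operations,
    which is not automatic since a product of quotient maps need not be a
    quotient map: the sets [U] form a base and each is pulled back from a
    finite discrete topological algebra, so that [A/theta] inherits continuity
    from those algebras ([residually_discrete_topological_algebra]). *)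

Local Open Scope classical_set_scope.
Local Open Scope quotient_scope.

(** * Continuous maps and discrete algebras *)

Lemma compact_locally_constant_finite {T : topologicalType}
    {B : discreteTopologicalType} (f : T -> B) :
  compact [set: T] -> continuous f -> finite_set (range f).
Proof.
move=> /compact_near_coveringP cT cf.
(* Compactness along the finite subsets of B ordered by inclusion: near each
   point, f takes its values in all sufficiently large finite sets. *)
pose G := filter_from (@finite_set B) (fun D => [set D' | D `<=` D']).
have FG : Filter G.
  apply: filter_from_filter; first by exists set0; exact: finite_set0.
  move=> D D' fD fD'; exists (D `|` D'); first by rewrite finite_setU.
  by move=> C sC; split=> x Dx; apply: sC; [left|right].
have [x _|D fD cover] := cT _ G (fun D x => D (f x)) FG.
  exists (f @^-1` [set f x], [set D : set B | [set f x] `<=` D]).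
    split; first exact/cf/discrete_set1.
    by exists [set f x] => //; exact: finite_set1.
  by move=> [y D] [/= -> sD]; apply: sD.
apply: sub_finite_set fD => _ [x _ <-].
exact: (cover D).
Qed.

Lemma ptws_continuous {T : topologicalType} {I : Type} {B : topologicalType}
    (f : T -> {ptws I -> B}) :
  (forall i, continuous (fun x => f x i)) -> continuous f.
Proof.
move=> cf x; apply/cvg_sup => i U [V [[W oW <-] /= Wfx] sVU].
have := cf i x W (open_nbhs_nbhs (conj oW Wfx)).
change (nbhs x [set y | W (f y i)] -> nbhs x (f @^-1` U)).
by apply: filterS => y Wy; apply: sVU.
Qed.

Lemma ptws_comp_continuous {n : nat} {A B : topologicalType} (f : A -> B) :
  continuous f ->
  continuous (fun a : {ptws 'I_n -> A} => (f \o a : {ptws 'I_n -> B})).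
Proof.
move=> cf; apply: ptws_continuous => i a.
by apply: continuous_comp; [exact: proj_continuous | exact: cf].
Qed.

(** Finite arities make [B^n] discrete, so only the dependence on the
    operation symbol [w] matters. *)
Lemma discrete_operations_continuous {Omega : signature}
    {B : discreteTopologicalType} (F : operations Omega B) :
  (forall n (b : 'I_n -> B), continuous (fun w => F n (w, b))) ->
  topological_algebra F.
Proof.
move=> cF n [w b] U FU.
exists ([set w' | U (F n (w', b))], [set b' | forall i, b' i = b i]).
  split; first exact: cF.
  have := @filter_forall _ _ (fun i (b' : {ptws 'I_n -> B}) => b' i = b i)
    (nbhs (b : {ptws 'I_n -> B})) _.
  apply=> i.
  exact: (@proj_continuous 'I_n (fun=> B) i b _ (discrete_set1 (b i))).
move=> [w' b'] [/= Uw' eqb].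
by have -> : b' = b by apply/funext.
Qed.

(** The hypothesis makes the topology of [A] the initial one for a family of
    homomorphisms to topological algebras, and along these the operations of
    [A] become continuous ones. *)
Lemma residually_discrete_topological_algebra {Omega : signature}
    {A : topologicalType} (E : operations Omega A) :
  (forall (x : A) (U : set A), nbhs x U ->
    exists (B : discreteTopologicalType) (F : operations Omega B)
           (phi : A -> B),
      [/\ topological_algebra F, continuous phi, homomorphism E F phi
        & phi @^-1` [set phi x] `<=` U]) ->
  topological_algebra E.
Proof.
move=> sepE n [w a] U /sepE [B] [F] [phi] [cF cphi homphi sU].
pose phin (p : Omega n * {ptws 'I_n -> A}) : Omega n * {ptws 'I_n -> B} :=
  (p.1, phi \o p.2).
have cphin : continuous phin.
  move=> [w' a'] W [[W1 W2] [/= W1w W2a] sW].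
  exists (W1, (fun a : {ptws 'I_n -> A} => phi \o a) @^-1` W2).
    by split=> //; exact: ptws_comp_continuous W2a.
  by move=> [w2 a2] [/= ? ?]; apply: sW.
have : nbhs (w, a) [set p | F n (phin p) = F n (phin (w, a))].
  exact: (cphin (w, a) _ (cF n (phin (w, a)) _ (discrete_set1 _))).
by apply: filterS => -[w' a'] /=; rewrite -!homphi => /sU.
Qed.

(** * Open congruences *)

(** All classes being open is equivalent to [R] being open in [A * A], and to
    continuity of the projection to the discrete space [A/R]. *)
Record open_congruence {Omega : signature} {A : topologicalType}
    (E : operations Omega A) (R : A -> A -> Prop) : Prop := OpenCongruence {
  ocong_refl : forall x, R x x;
  ocong_sym : forall x y, R x y -> R y x;
  ocong_trans : forall x y z, R x y -> R y z -> R x z;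
  ocong_compat : forall n (w : Omega n) (a b : 'I_n -> A),
    (forall i, R (a i) (b i)) -> R (E n (w, a)) (E n (w, b));
  ocong_open : forall x, open [set y | R x y]
}.
Arguments ocong_refl {Omega A E R}.
Arguments ocong_sym {Omega A E R}.
Arguments ocong_trans {Omega A E R}.
Arguments ocong_compat {Omega A E R}.
Arguments ocong_open {Omega A E R}.

Section Congruences.
Context {Omega : signature} {A : topologicalType} (E : operations Omega A).

Lemma open_congruence_total : open_congruence E (fun _ _ => True).
Proof. by split=> // x; exact: openT. Qed.

Lemma open_congruenceI {R S : A -> A -> Prop} :
  open_congruence E R -> open_congruence E S ->
  open_congruence E (fun x y => R x y /\ S x y).
Proof.
move=> cR cS; split.
- by move=> x; split; [apply: (ocong_refl cR) | apply: (ocong_refl cS)].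
- move=> x y [Rxy Sxy].
  by split; [exact: (ocong_sym cR) | exact: (ocong_sym cS)].
- move=> x y z [Rxy Sxy] [Ryz Syz].
  split; first exact: (ocong_trans cR _ _ _ Rxy Ryz).
  exact: (ocong_trans cS _ _ _ Sxy Syz).
- move=> n w a b ab.
  by split; [apply: (ocong_compat cR) | apply: (ocong_compat cS)] => i;
    case: (ab i).
- by move=> x; apply: openI; [apply: (ocong_open cR) | apply: (ocong_open cS)].
Qed.

Lemma open_congruence_kernel {B : discreteTopologicalType}
    {F : operations Omega B} {phi : A -> B} :
  continuous phi -> homomorphism E F phi ->
  open_congruence E (fun x y => phi x = phi y).
Proof.
move=> /continuousP cphi homphi; split=> //.
- by move=> x y z -> ->.
- move=> n w a b ab; rewrite !homphi.
  by have -> : phi \o a = phi \o b by apply/funext.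
- move=> x; rewrite [X in open X](_ : _ = phi @^-1` [set phi x]).
    exact/cphi/discrete_open.
  by apply/seteqP; split=> y /= ->.
Qed.

(** A chain can be followed in one argument at a time, so the equivalence
    generated by a relation is compatible as soon as the relation is compatible
    in each argument separately. The union of two congruences is in general
    compatible in this weak sense only. *)
Lemma clos_rst_compatible (R : A -> A -> Prop) :
  (forall n (w : Omega n) (a : 'I_n -> A) i x y, R x y ->
    R (E n (w, dfwith a i x)) (E n (w, dfwith a i y))) ->
  forall n (w : Omega n) (a b : 'I_n -> A),
    (forall i, clos_refl_sym_trans A R (a i) (b i)) ->
    clos_refl_sym_trans A R (E n (w, a)) (E n (w, b)).
Proof.
move=> R1 n w a b ab.
have T1 c i x y : clos_refl_sym_trans A R x y ->
    clos_refl_sym_trans A R (E n (w, dfwith c i x)) (E n (w, dfwith c i y)).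
  elim=> {x y} [x y Rxy|x|x y _ IH|x y z _ IHxy _ IHyz].
  - exact/rst_step/R1.
  - exact: rst_refl.
  - exact: rst_sym.
  - exact: rst_trans IHxy IHyz.
(* Replace the coordinates of a by those of b, one index of s after another. *)
pose mix (s : seq 'I_n) i := if i \in s then b i else a i.
have mixP s : clos_refl_sym_trans A R (E n (w, a)) (E n (w, mix s)).
  elim: s => [|i s IH]; first exact: rst_refl.
  apply: rst_trans IH _.
  have -> : mix s = dfwith (mix s) i (mix s i).
    by apply/funext => j; case: dfwithP.
  have -> : mix (i :: s) = dfwith (mix s) i (b i).
    apply/funext => j; case: dfwithP => [|k ik]; rewrite /mix inE ?eqxx //.
    by rewrite eq_sym (negbTE ik).
  by apply: T1; rewrite /mix; case: ifP => // _; exact: rst_refl.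
have -> : b = mix (enum 'I_n) by apply/funext => i; rewrite /mix mem_enum.
exact: mixP.
Qed.

(** The generated equivalence is the join of [theta] and [R]; its classes are
    unions of [R]-classes, hence open. *)
Lemma open_congruence_join {theta : equiv_rel A} {R : A -> A -> Prop} :
  compatible E theta -> open_congruence E R ->
  open_congruence E
    (clos_refl_sym_trans A (fun x y => theta x y \/ R x y)).
Proof.
move=> ctheta cR; split.
- exact: rst_refl.
- exact: rst_sym.
- exact: rst_trans.
- apply: clos_rst_compatible => n w a i x y [xy|xy]; [left|right].
    apply: ctheta => j; case: dfwithP => [|k ik].
      by rewrite dfwithin.
    by rewrite dfwithout // equiv_refl.
  apply: (ocong_compat cR) => j; case: dfwithP => [|k ik].
    by rewrite dfwithin.
  by rewrite dfwithout //; exact: (ocong_refl cR).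
- move=> x; rewrite openE => y xy.
  have oy : open_nbhs y [set z | R y z].
    by split; [exact: (ocong_open cR) | exact: (ocong_refl cR)].
  apply: filterS (open_nbhs_nbhs oy) => z yz.
  by apply: rst_trans xy _; apply: rst_step; right.
Qed.

(** The open congruences of a profinite algebra are directed, and their
    intersection is equality, so by compactness a single one of them separates
    [V] from its complement. *)
Lemma clopen_saturated_open_congruence {V : set A} :
  profinite E -> clopen V ->
  exists2 R, open_congruence E R & forall x y, R x y -> V x -> V y.
Proof.
move=> [_ _ cA rfA] [oV cV].
have cVC (W : set A) : closed W -> compact W.
  by move=> cW; exact: subclosed_compact cW cA _.
have cK : compact (V `*` ~` V).
  by apply: compact_setX; apply: cVC => //; exact: open_closedC.
(* Compactness along the open congruences, directed by refinement: near each
   pair of K, all sufficiently fine relations keep the coordinates apart. *)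
pose G := filter_from (open_congruence E)
  (fun R => [set S : A -> A -> Prop | forall x y, S x y -> R x y]).
have FG : Filter G.
  apply: filter_from_filter; first exists (fun _ _ => True).
    exact: open_congruence_total.
  move=> R S cR cS; exists (fun x y => R x y /\ S x y).
    exact: open_congruenceI.
  by move=> T sT; split=> x y /sT [].
have [[x y] [/= Vx nVy]|R cR sep] :=
    (iffLR (compact_near_coveringP _) cK) _ G (fun R p => ~ R p.1 p.2) FG.
  have [|B [F [phi [_ _ cphi homphi phixy]]]] := rfA x y.
    by move=> xy; apply: nVy; rewrite -xy.
  exists ((phi @^-1` [set phi x]) `*` (phi @^-1` [set phi y]),
      [set S : A -> A -> Prop | forall x y, S x y -> phi x = phi y]).
    split; last first.
      exists (fun x y => phi x = phi y) => //.
      exact: open_congruence_kernel cphi homphi.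
    exists (phi @^-1` [set phi x], phi @^-1` [set phi y]) => //.
    by split; apply: cphi; exact: discrete_set1.
  by move=> [[x' y'] S] [/= [fx fy] sS] /sS; rewrite fx fy.
exists R => // x y Rxy Vx; apply: contrapT => nVy.
exact: (sep R (fun _ _ => id) (x, y)).
Qed.

(** Open classes make the projection to the discrete quotient continuous, and
    compactness leaves only finitely many of them. *)
Lemma open_congruence_quotient {R : A -> A -> Prop} :
  topological_algebra E -> compact [set: A] -> open_congruence E R ->
  exists (B : discreteTopologicalType) (F : operations Omega B) (phi : A -> B),
    [/\ finite_set [set: B], topological_algebra F, continuous phi,
        homomorphism E F phi & forall x y, phi x = phi y <-> R x y].
Proof.
move=> cE cA cR.
pose r x y := `[< R x y >].
have r_refl : reflexive r by move=> x; apply/asboolP/(ocong_refl cR).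
have r_sym : symmetric r.
  by move=> x y; apply/asboolP/asboolP; apply: (ocong_sym cR).
have r_trans : transitive r.
  move=> y x z /asboolP Rxy /asboolP Ryz; apply/asboolP.
  exact: (ocong_trans cR _ _ _ Rxy Ryz).
pose rho := EquivRel r r_refl r_sym r_trans.
pose B : discreteTopologicalType := discrete_topology {eq_quot rho}.
pose phi (x : A) : B := \pi_{eq_quot rho} x.
pose sec (b : B) : A := repr (b : {eq_quot rho}).
have phiP x y : phi x = phi y <-> R x y.
  by split=> [/eqmodP/asboolP|Rxy] //; apply/eqmodP/asboolP.
have secK : cancel sec phi by move=> b; exact: reprK.
have cphi : continuous phi.
  apply/continuousP => W _; rewrite openE => x Wx.
  have ox : open_nbhs x [set y | R x y].
    by split; [exact: (ocong_open cR) | exact: (ocong_refl cR)].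
  by apply: filterS (open_nbhs_nbhs ox) => y /phiP; rewrite /preimage /= => <-.
pose F : operations Omega B := fun n p => phi (E n (p.1, sec \o p.2)).
exists B, F, phi; split=> //.
- apply: sub_finite_set (compact_locally_constant_finite _ cA cphi) => b _.
  by exists (sec b).
- apply: discrete_operations_continuous => n b w.
  have cw : continuous (fun w' => (w', sec \o b) : Omega n * {ptws 'I_n -> A}).
    move=> w' W [[W1 W2] [/= W1w W2b] sW]; apply: filterS W1w => v Wv.
    by apply: sW; split=> //; exact: nbhs_singleton W2b.
  exact: (continuous_comp (cw w) (continuous_comp (cE n _) (cphi _))).
- move=> n w a; apply/phiP; apply: (ocong_compat cR) => i /=.
  by apply/phiP; rewrite secK.
Qed.

(** The finite algebra is the quotient of [A] by the join of [theta] with an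
    open congruence that saturates the preimage of [U]. *)
Lemma clopen_finite_quotient {theta : equiv_rel A}
    {U : set (quotient_space theta)} :
  profinite E -> compatible E theta -> clopen U ->
  exists (B : discreteTopologicalType) (F : operations Omega B)
         (psi : quotient_space theta -> B),
    [/\ finite_set [set: B], topological_algebra F, continuous psi,
        homomorphism (quotient_operations E theta) F psi
      & forall x y, psi x = psi y -> U x -> U y].
Proof.
move=> pE ctheta [oU cU].
have [cE _ cA _] := pE.
pose p := \pi_(quotient_topology {eq_quot theta}) : A -> quotient_space theta.
have cp : continuous p by exact: pi_continuous.
have clV : clopen (p @^-1` U).
  by split; [apply: open_comp => // | apply: preimage_closed => //].
have [R cR satR] := clopen_saturated_open_congruence pE clV.
have cJ := open_congruence_join ctheta cR.
set J := clos_refl_sym_trans _ _ in cJ.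
have satJ x y : J x y -> U (p x) <-> U (p y).
  elim=> {x y} [x y [xy|xy]|x|x y _ []|x y z _ -> _ ->] //.
    by have -> : p x = p y by apply/eqmodP.
  by split; [apply: (satR _ _ xy) | apply: (satR _ _ (ocong_sym cR _ _ xy))].
have [B [F [phi [finB cF cphi homphi phiP]]]] :=
  open_congruence_quotient cE cA cJ.
pose psi (q : quotient_space theta) := phi (repr (q : {eq_quot theta})).
have psiE x : psi (p x) = phi x.
  apply/phiP; apply: rst_step; left.
  by apply/eqmodP; rewrite reprK.
exists B, F, psi; split=> //.
- apply/quotient_continuous.
  by have -> : psi \o \pi_(quotient_topology {eq_quot theta}) = phi
    by apply/funext => x; exact: psiE.
- by move=> n w a; rewrite /quotient_operations psiE homphi.
- move=> x y /phiP /satJ; rewrite /p.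
  by rewrite !(reprK (_ : quotient_topology {eq_quot theta})) => <-.
Qed.

End Congruences.

(** * Quotients with a clopen base *)

(** Classes of [theta] are closed in [A], so the complement of a point is open
    in [A/theta] and contains a basic clopen neighbourhood of any other
    point. *)
Lemma quotient_clopen_separation {A : topologicalType} {theta : equiv_rel A} :
  closed [set p : A * A | theta p.1 p.2] ->
  has_clopen_base (quotient_space theta) ->
  forall q q' : quotient_space theta, q <> q' ->
    exists U, [/\ clopen U, U q & ~ U q'].
Proof.
move=> cltheta [_ baseQ] q q' qq'.
pose y := repr (q' : {eq_quot theta}).
have o : open (~` [set q']).
  suff : open [set z | ~ theta z y].
    rewrite /open /= /quotient_open; congr open.
    apply/seteqP; split=> z /=.
      by move=> nzy zq'; apply: nzy; apply/eqmodP; rewrite /y reprK.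
    by move=> nzq' /eqmodP zy; apply: nzq'; rewrite -(reprK q') -/y.
  apply: (@open_comp _ _ (fun z => (z, y)) (~` [set p | theta p.1 p.2])).
    by move=> z _; apply: cvg_pair; [exact: cvg_id | exact: cvg_cst].
  exact: closed_openC.
have [|U [clU Uq] sU] := baseQ q (~` [set q']); first exact: open_nbhs_nbhs.
by exists U; split=> // Uq'; exact: sU Uq' erefl.
Qed.

Theorem theorem4p2 (Omega : signature) (A : topologicalType)
    (E : operations Omega A) (theta : equiv_rel A) :
  profinite E ->
  compatible E theta ->
  closed [set p : A * A | theta p.1 p.2] ->
  has_clopen_base (quotient_space theta) ->
  profinite (quotient_operations E theta).
Proof.
move=> pE ctheta cltheta bclopen.
have [_ _ cA _] := pE.
have clopen_sep := quotient_clopen_separation cltheta bclopen.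
have [_ baseQ] := bclopen.
split.
- apply: residually_discrete_topological_algebra => q W /baseQ [U [clU Uq] sUW].
  have [B [F [psi [_ cF cpsi hpsi sat]]]] :=
    clopen_finite_quotient E pE ctheta clU.
  exists B, F, psi; split=> // q' /= qq'.
  by apply: sUW; apply: sat Uq.
- move=> q q' clu; apply: contrapT => /clopen_sep [U [[oU cU] Uq nUq']].
  have [z [Uz]] := clu U (~` U) (open_nbhs_nbhs (conj oU Uq))
    (open_nbhs_nbhs (conj (closed_openC cU) nUq')).
  by apply.
- pose p := \pi_(quotient_topology {eq_quot theta}) : A -> quotient_space theta.
  rewrite (_ : [set: _] = p @` [set: A]).
    by apply: continuous_compact cA; exact/continuous_subspaceT/pi_continuous.
  apply/seteqP; split=> // q _.
  by exists (repr (q : {eq_quot theta})); rewrite /p ?reprK.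
- move=> q q' /clopen_sep [U [clU Uq nUq']].
  have [B [F [psi [fB cF cpsi hpsi sat]]]] :=
    clopen_finite_quotient E pE ctheta clU.
  by exists B, F, psi; split=> // qq'; apply/nUq'/(sat q).
Qed.
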